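(* Let $\mathcal{D}$ be a $d$-element difference set in a finite abelian group $\mathcal{G}$ of order $n>d$ (with $d\ge1$), and let $s=\left[\frac{d(n-1)}{n-d}\right]^{1/2}$. If there exists a subgroup $\mathcal{H}$ of $\mathcal{G}$ of order $v:=\frac{|\mathcal{G}|}{s+1}$ that is disjoint from $\mathcal{D}$, then the harmonic equiangular tight frame corresponding to $\mathcal{D}$ is a disjoint union of $v$ regular $s$-simplices.
   Context: A subset $\mathcal{D}$ of a finite abelian group $\mathcal{G}$ (written additively) is a difference set if $\#\{(d,d')\in\mathcal{D}\times\mathcal{D}: g=d-d'\}$ is constant over all $g\in\mathcal{G}$, $g\neq0$. Let $\Gamma$ be the Pontryagin dual of $\mathcal{G}$, i.e. the group of all homomorphisms $\gamma:\mathcal{G}\to\{z\in\mathbb{C}:|z|=1\}$. The harmonic equiangular tight frame (ETF) corresponding to a difference set $\mathcal{D}$ is the sequence of $n$ vectors $\{\varphi_\gamma\}_{\gamma\in\Gamma}$ in $\mathbb{C}^{\mathcal{D}}\cong\mathbb{C}^d$ given by $\varphi_\gamma(g)=\gamma(g)$ for $g\in\mathcal{D}$; it is known to be an ETF for $\mathbb{C}^{\mathcal{D}}$. A finite sequence of nonzero vectors $\{\varphi_l\}$ in a Hilbert space $\mathbb{H}$ is an ETF for $\mathbb{H}$ if all vectors have equal norm, $|\langle\varphi_l,\varphi_{l'}\rangle|$ is constant over all $l\neq l'$, and there is $a>0$ such that $\sum_{l}\langle\varphi_l,y\rangle\varphi_l=ay$ for all $y\in\mathbb{H}$ (inner products are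 conjugate-linear in the first argument). For a positive integer $s$, a regular $s$-simplex is a sequence of $s+1$ vectors that is an ETF for its span, where this span has dimension $s$. An ETF is a disjoint union of $v$ regular $s$-simplices if its index set can be partitioned into $v$ subsets $\mathcal{K}_1,\dots,\mathcal{K}_v$ such that, for each $i$, the vectors indexed by $\mathcal{K}_i$ form a regular $s$-simplex. *)

(* Defs.v *)
From HB Require Import structures.
From mathcomp Require Import all_boot all_order all_algebra all_fingroup.
From mathcomp Require Import reals complex.

Set Implicit Arguments.
Unset Strict Implicit.
Unset Printing Implicit Defensive.

Import Order.TTheory GRing.Theory Num.Theory.

Local Open Scope ring_scope.

Definition difference_set (G : finZmodType) (D : {set G}) : Prop :=
  exists lambda : nat, forall g : G, g != 0 ->
    #|[set p in setX D D | g == p.1 - p.2]| = lambda.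

(* Homomorphisms from the additive group G to the complex unit circle.  Such
   functions are valued in the #|G|-th roots of unity, so the dual is finite. *)

Definition is_character (C : numClosedFieldType) (G : finZmodType)
    (f : {ffun G -> C}) : bool :=
  [forall x, `|f x| == 1] && [forall x, forall y, f (x + y) == f x * f y].

Record pontryagin (C : numClosedFieldType) (G : finZmodType) :=
  Dual { dual_fun :> {ffun G -> C}; _ : is_character dual_fun }.

HB.instance Definition _ (C : numClosedFieldType) (G : finZmodType) :=
  [isSub of pontryagin C G for @dual_fun C G].
HB.instance Definition _ (C : numClosedFieldType) (G : finZmodType) :=
  [Choice of pontryagin C G by <:].

Lemma dual_norm (C : numClosedFieldType) (G : finZmodType) (f : pontryagin C G) x :
  `|f x| = 1.
Proof. by case: f => f /= /andP[/forallP/(_ x)/eqP]. Qed.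

Lemma dualD (C : numClosedFieldType) (G : finZmodType) (f : pontryagin C G) x y :
  f (x + y) = f x * f y.
Proof. by case: f => f /= /andP[_ /forallP/(_ x)/forallP/(_ y)/eqP]. Qed.

Lemma dual0 (C : numClosedFieldType) (G : finZmodType) (f : pontryagin C G) : f 0 = 1.
Proof.
have f0 : f 0 != 0 by rewrite -normr_eq0 dual_norm oner_eq0.
by apply: (mulfI f0); rewrite -dualD addr0 mulr1.
Qed.

Lemma dualMn (C : numClosedFieldType) (G : finZmodType) (f : pontryagin C G) x k :
  f (x *+ k) = f x ^+ k.
Proof.
by elim: k => [|k IHk]; rewrite ?mulr0n ?dual0 // mulrS dualD IHk exprS.
Qed.

Lemma dual_exp_card (C : numClosedFieldType) (G : finZmodType) (f : pontryagin C G) x :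
  f x ^+ #|G| = 1.
Proof.
have /dvdnP[k Ek] : (#[x]%g %| #|G|)%N by rewrite -cardsT cardSg ?subsetT.
rewrite -dualMn Ek mulnC -FinRing.zmodXgE expgM expg_order expg1n.
by rewrite FinRing.zmod1gE dual0.
Qed.

Definition unity_roots (C : numClosedFieldType) (n : nat) : seq C :=
  sval (closed_field_poly_normal ('X^n - 1 : {poly C})).

Lemma mem_unity_roots (C : numClosedFieldType) (n : nat) (z : C) :
  (0 < n)%N -> z ^+ n = 1 -> z \in unity_roots C n.
Proof.
move=> n_gt0 zn1; rewrite /unity_roots.
case: closed_field_poly_normal => r /= Er.
have: root ('X^n - 1) z by rewrite rootE !hornerE zn1 subrr.
have lc1 : lead_coef ('X^n - 1 : {poly C}) = 1 by rewrite -polyC1 lead_coefXnsubC.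
by rewrite Er lc1 scale1r root_prod_XsubC.
Qed.

Lemma dual_in_unity_roots (C : numClosedFieldType) (G : finZmodType)
  (f : pontryagin C G) x : f x \in unity_roots C #|G|.
Proof.
apply: mem_unity_roots; last exact: dual_exp_card.
by apply/card_gt0P; exists 0.
Qed.

Definition dual_encode (C : numClosedFieldType) (G : finZmodType)
    (f : pontryagin C G) : {ffun G -> seq_sub (unity_roots C #|G|)} :=
  [ffun x => SeqSub (dual_in_unity_roots f x)].

Definition dual_decode (C : numClosedFieldType) (G : finZmodType)
    (h : {ffun G -> seq_sub (unity_roots C #|G|)}) : option (pontryagin C G) :=
  insub [ffun x => ssval (h x)].

Lemma dual_encodeK (C : numClosedFieldType) (G : finZmodType) :
  pcancel (@dual_encode C G) (@dual_decode C G).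
Proof.
move=> f; rewrite /dual_decode.
have -> : [ffun x => ssval (dual_encode f x)] = val f.
  by apply/ffunP => x; rewrite !ffunE.
exact: valK.
Qed.

HB.instance Definition _ (C : numClosedFieldType) (G : finZmodType) :=
  PCanIsCountable (@dual_encodeK C G).
HB.instance Definition _ (C : numClosedFieldType) (G : finZmodType) :
  isFinite (pontryagin C G) := PCanIsFinite (@dual_encodeK C G).

(* The Hilbert space C^X.  The regular module C^o is only there so that the
   library equips the space with its vector space structure over C. *)
Notation hilbert C X := {ffun X -> C^o}.

Definition inner (C : numClosedFieldType) (X : finType)
  (u v : hilbert C X) : C := \sum_x ((u x)^* * v x).

Definition hnorm (C : numClosedFieldType) (X : finType)
  (u : hilbert C X) : C := sqrtC (inner u u).

(* The vectors phi l, l in K, form an ETF for the subspace U. *)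
Definition is_ETF (C : numClosedFieldType) (X I : finType)
    (K : {set I}) (phi : I -> hilbert C X) (U : {vspace hilbert C X}) : Prop :=
  [/\ forall l, l \in K -> phi l \in U /\ phi l != 0,
      exists r : C, forall l, l \in K -> hnorm (phi l) = r,
      exists c : C, forall l l', l \in K -> l' \in K -> l != l' ->
        `|inner (phi l) (phi l')| = c
    & exists2 a : C, 0 < a & forall y, y \in U ->
        \sum_(l in K) inner (phi l) y *: phi l = a *: y].

Definition regular_simplex (C : numClosedFieldType) (X I : finType)
    (s : nat) (K : {set I}) (phi : I -> hilbert C X) : Prop :=
  let U := <<[seq phi l | l in K]>>%VS in
  [/\ (0 < s)%N, #|K| = s.+1, is_ETF K phi U & \dim U = s].

Definition ETF_disjoint_union_of_simplices (C : numClosedFieldType)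
    (X I : finType) (v s : nat) (phi : I -> hilbert C X) : Prop :=
  is_ETF [set: I] phi fullv /\
  exists P : {set {set I}},
    [/\ partition P [set: I], #|P| = v
      & forall K, K \in P -> regular_simplex s K phi].

Definition harmonic (C : numClosedFieldType) (G : finZmodType) (D : {set G})
    (gamma : pontryagin C G) : hilbert C {g : G | g \in D} :=
  [ffun g => gamma (val g)].
Arguments harmonic C {G} D gamma.

(* Main.v *)
Require Import Defs.
From HB Require Import structures.
From mathcomp Require Import all_boot all_order all_algebra all_fingroup.
From mathcomp Require Import separable cyclotomic.
From mathcomp Require Import reals complex.

(**
Write n for the order of G and let H-perp be the group of characters that are
trivial on H.  The simplices are the families of harmonic vectors indexed by the
cosets of H-perp in the dual of G, that is, by the classes of characters having
the same restriction to H.  There are #|H| such classes and each has n / #|H|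
elements, which is s + 1 by hypothesis; in particular s is an integer k.

By Poisson summation ([sum_dual_coset]), the sum of the characters of one class
vanishes at every point outside H.  Since D avoids H, the k + 1 harmonic vectors
of a class add up to 0.  Each of them has squared norm #|D|, and the difference
set property makes the modulus of the inner product of any two distinct ones
equal to the Welch bound c = #|D| / k ([sqr_norm_inner_harmonic]).  Pairing the
zero sum with one of the vectors therefore gives k numbers of modulus c whose sum
is - c * k: the triangle inequality is an equality, so all of them equal - c
([simplex_gram]).  Hence the Gram matrix of the class is c ((k + 1) I - J), with
J the all-ones matrix.  It has rank k and is c (k + 1) times a projection, which
is what a regular k-simplex is ([simplex_of_zero_sum]).

Counting the classes, computing the coset sums and proving that the whole
harmonic family is a tight frame all rest on the column orthogonality of
characters ([sum_characters]).  It follows from row orthogonality, which is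
elementary, once the characters are known to span the functions on G.  For that,
view the functions as row vectors: the translation operators commute and have
finite order, so they are simultaneously diagonalizable, and a common eigenvector
is a scalar multiple of a character ([character_of_quasi_period],
[characters_span]).
*)

Set Implicit Arguments.
Unset Strict Implicit.
Unset Printing Implicit Defensive.

Import Order.TTheory GRing.Theory Num.Theory.

Local Open Scope ring_scope.

(** * Characters of a finite abelian group *)

Lemma Xn_sub_1_unity_roots (C : numClosedFieldType) (m : nat) :
  (0 < m)%N -> 'X^m - 1 = \prod_(z <- unity_roots C m) ('X - z%:P).
Proof.
move=> m_gt0; rewrite /unity_roots; case: closed_field_poly_normal => r /= Er.
have lc1 : lead_coef ('X^m - 1 : {poly C}) = 1.
  by rewrite -polyC1 lead_coefXnsubC.
by rewrite [LHS]Er lc1 scale1r.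
Qed.

(** The minimal polynomial divides X^m - 1, which has simple roots in
    characteristic 0. *)
Lemma diagonalizable_finite_order (C : numClosedFieldType) (N m : nat)
    (A : 'M[C]_N.+1) :
  (0 < m)%N -> A ^+ m = 1 ->
  exists2 P : 'M_N.+1, P \in unitmx & similar_diag P A.
Proof.
move=> m_gt0 Am; apply/diagonalizableP; exists (unity_roots C m).
  rewrite -separable_prod_XsubC -Xn_sub_1_unity_roots //.
  by rewrite separable_Xn_sub_1 // pnatr_eq0 -lt0n.
rewrite -Xn_sub_1_unity_roots // mxminpoly_min //.
by rewrite rmorphB rmorphXn rmorph1 /= horner_mx_X Am subrr.
Qed.

Section Characters.
Variables (C : numClosedFieldType) (G : finZmodType).

(** A common eigenvector u of all translations is determined by its value at 0.
    The eigenvalue c is multiplicative, and unimodular because G has finite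
    exponent. *)
Lemma character_of_quasi_period (u : G -> C) (c : G -> C) (x0 : G) :
    u x0 != 0 -> (forall x y, u (x + y) = c x * u y) ->
  exists chi : pontryagin C G, forall x, u x = u 0 * chi x.
Proof.
move=> ux0 uD.
have u0 x : u x = c x * u 0 by rewrite -[x in LHS]addr0 uD.
have u0_neq0 : u 0 != 0.
  by apply: contraNneq ux0 => u00; rewrite u0 u00 mulr0.
have c0 : c 0 = 1 by apply: (mulIf u0_neq0); rewrite -u0 mul1r.
have cD x y : c (x + y) = c x * c y.
  by apply: (mulIf u0_neq0); rewrite -u0 uD -mulrA -u0.
have cM x k : c (x *+ k) = c x ^+ k.
  by elim: k => [|k IHk]; rewrite ?mulr0n // mulrS cD IHk exprS.
have c_norm x : `|c x| = 1.
  have n_gt0 : (0 < #|G|)%N by apply/card_gt0P; exists 0.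
  apply: (pexpIrn n_gt0); rewrite ?nnegrE ?ler01 ?normr_ge0 //.
  rewrite expr1n -normrX -cM.
  have /dvdnP[k Ek] : (#[x]%g %| #|G|)%N by rewrite -cardsT cardSg ?subsetT.
  rewrite Ek mulnC -FinRing.zmodXgE expgM expg_order expg1n.
  by rewrite FinRing.zmod1gE c0 normr1.
have c_char : is_character [ffun x => c x].
  apply/andP; split; first by apply/forallP=> x; rewrite ffunE c_norm.
  by apply/forallP=> x; apply/forallP=> y; rewrite !ffunE cD.
by exists (Dual c_char) => x; rewrite /= ffunE mulrC.
Qed.

(** The rows of a matrix diagonalizing all the translations at once are scalar
    multiples of characters, and they form a basis. *)
Lemma characters_span (f : G -> C) :
  exists (m : nat) (a : 'I_m -> C) (chi : 'I_m -> pontryagin C G),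
    forall x, f x = \sum_(i < m) a i * chi i x.
Proof.
have [N EN] : exists N, #|G| = N.+1.
  by exists #|G|.-1; rewrite prednK //; apply/card_gt0P; exists 0.
pose r (x : G) : 'I_N.+1 := cast_ord EN (enum_rank x).
pose e (i : 'I_N.+1) : G := enum_val (cast_ord (esym EN) i).
have rK x : e (r x) = x by rewrite /e /r cast_ordK enum_rankK.
have eK i : r (e i) = i by rewrite /e /r enum_valK cast_ordKV.
(* In terms of functions u on G, right multiplication by T x sends u to
   y |-> u (x + y). *)
pose T x : 'M[C]_N.+1 := \matrix_(i, j) (e i == x + e j)%:R.
have uT (u : 'rV[C]_N.+1) x y : (u *m T x) 0 (r y) = u 0 (r (x + y)).
  rewrite mxE (bigD1 (r (x + y))) //= mxE !rK eqxx mulr1 big1 ?addr0 // => i neq_i.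
  rewrite mxE rK (negPf (_ : e i != x + y)) ?mulr0 //.
  by apply: contraNneq neq_i => <-; rewrite eK.
have TE A B :
    (forall (u : 'rV[C]_N.+1) y, (u *m A) 0 (r y) = (u *m B) 0 (r y)) -> A = B.
  move=> AB; apply/row_matrixP => i; apply/rowP => j.
  by rewrite !rowE -(eK j) AB.
have TD x y : T x *m T y = T (x + y).
  by apply: TE => u z; rewrite mulmxA !uT addrA.
have T0 : T 0 = 1.
  by apply: TE => u z; rewrite uT add0r mulmx1.
have TX x k : T x ^+ k = T (x *+ k).
  elim: k => [|k IHk]; first by rewrite T0.
  by rewrite exprS IHk mulrS -TD.
have [|P Pu /allP PT] := (codiagonalizableP [seq T x | x <- enum G]).1.
  split=> [A B /mapP[x _ ->] /mapP[y _ ->]|A /mapP[x _ ->]].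
    by rewrite /comm_mx !TD addrC.
  apply: (diagonalizable_finite_order (order_gt0 x)).
  by rewrite TX -FinRing.zmodXgE expg_order.
have rowT i x : exists c, row i P *m T x = c *: row i P.
  have /PT/= : T x \in [seq T x | x <- enum G] by apply: map_f; rewrite mem_enum.
  move=> /diagonalizable_forPex[d /(simmxP Pu) E].
  by exists (d 0 i); rewrite -row_mul E row_mul row_diag_mx -scalemxAl -rowE.
have chiP i : exists chi : pontryagin C G,
    forall x, P i (r x) = P i (r 0) * chi x.
  have /rV0Pn[j Pij] : row i P != 0.
    apply/eqP => Pi0; have /rowP/(_ i)/eqP := congr1 (row i) (mulmxV Pu).
    by rewrite row_mul Pi0 mul0mx !mxE eqxx eq_sym oner_eq0.
  have /fin_all_exists[c cP] := rowT i.
  apply: (@character_of_quasi_period (fun x => P i (r x)) c (e j)).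
    by rewrite eK; rewrite mxE in Pij.
  by move=> x y; have /rowP/(_ (r y)) := cP x; rewrite uT !mxE.
have /fin_all_exists[chi chiE] := chiP.
pose v : 'rV[C]_N.+1 := \row_i f (e i).
exists N.+1; exists (fun i => (v *m invmx P) 0 i * P i (r 0)).
exists chi => x.
transitivity ((v *m invmx P *m P) 0 (r x)).
  by rewrite mulmxKV // mxE rK.
by rewrite mxE; apply: eq_bigr => i _; rewrite (chiE i x) mulrA.
Qed.

Lemma dualN (chi : pontryagin C G) x : chi (- x) = (chi x)^*.
Proof.
have chix0 : chi x != 0 by rewrite -normr_eq0 dual_norm oner_eq0.
by apply: (mulfI chix0); rewrite -dualD subrr dual0 -normCK dual_norm expr1n.
Qed.

(** Translating by a point h of K where chi and psi differ multiplies the sum by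
    a factor other than 1, so the sum must vanish. *)
Lemma character_orthogonality (K : {group G}) (chi psi : pontryagin C G) :
  \sum_(x in K) (chi x)^* * psi x =
  if [forall x in K, chi x == psi x] then #|K|%:R else 0.
Proof.
case: ifP => [/forall_inP eq_cp|/negbT].
  transitivity (\sum_(x in K) (1 : C)); last by rewrite sumr_const.
  by apply: eq_bigr => x Kx; rewrite -(eqP (eq_cp x Kx)) mulrC -normCK dual_norm expr1n.
rewrite negb_forall_in => /exists_inP[h Kh neq_h].
set S := \sum_(_ in K) _; set t := (chi h)^* * psi h.
have St : S = t * S.
  rewrite {1}/S (reindex_inj (addrI h)) mulr_sumr.
  apply: eq_big => [x|x _]; last by rewrite !dualD rmorphM mulrACA.
  by rewrite /= -FinRing.zmodMgE groupMl.
have t1 : t != 1.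
  apply: contraNneq neq_h => t1; apply/eqP.
  by rewrite -[LHS]mulr1 -t1 mulrA -normCK dual_norm expr1n mul1r.
apply/eqP; have /eqP := St; rewrite -subr_eq0 -{1}[S]mul1r -mulrBl mulf_eq0.
by rewrite subr_eq0 eq_sym (negPf t1).
Qed.

Lemma character_orthogonalityT (chi psi : pontryagin C G) :
  \sum_x (chi x)^* * psi x = if chi == psi then #|G|%:R else 0.
Proof.
transitivity (\sum_(x in [set: G]%G) (chi x)^* * psi x).
  by apply: eq_bigl => x; rewrite inE.
rewrite character_orthogonality cardsT; congr (if _ then _ else _).
apply/forall_inP/eqP => [eq_cp|-> //].
by apply/val_inj/ffunP => x; apply/eqP/eq_cp; rewrite inE.
Qed.

(** Column orthogonality: by row orthogonality, f |-> sum of <gamma, f> gamma is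
    multiplication by #|G| on each character, hence on their span, which is
    everything; apply it to the delta function at 0. *)
Lemma sum_characters x :
  \sum_(gamma : pontryagin C G) gamma x = if x == 0 then #|G|%:R else 0.
Proof.
have repr (f : G -> C) y :
    \sum_(gamma : pontryagin C G) (\sum_z (gamma z)^* * f z) * gamma y
    = #|G|%:R * f y.
  have [m [a [chi fE]]] := characters_span f.
  have coefE (gamma : pontryagin C G) : \sum_z (gamma z)^* * f z =
      \sum_(i < m) a i * (if gamma == chi i then #|G|%:R else 0).
    under eq_bigr do rewrite fE mulr_sumr.
    rewrite exchange_big; apply: eq_bigr => i _.
    rewrite -character_orthogonalityT mulr_sumr.
    by apply: eq_bigr => z _; rewrite mulrCA.
  under eq_bigr do rewrite coefE mulr_suml.
  rewrite exchange_big fE mulr_sumr /=; apply: eq_bigr => i _.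
  rewrite (bigD1 (chi i)) //= big1 ?addr0 => [|gamma /negPf->].
    by rewrite eqxx [a i * _]mulrC mulrA.
  by rewrite mulr0 mul0r.
have := repr (fun z => (z == 0)%:R) x.
have delta (gamma : pontryagin C G) : \sum_z (gamma z)^* * (z == 0)%:R = 1.
  rewrite (bigD1 0) //= eqxx mulr1 big1 => [|z /negPf->]; last by rewrite mulr0.
  by rewrite dual0 conjC1 addr0.
under eq_bigr do rewrite delta mul1r.
by move=> ->; case: eqP; rewrite ?mulr1 ?mulr0.
Qed.

End Characters.

(** * Regular simplices *)

Lemma inner_sumr (C : numClosedFieldType) (X I : finType) (A : {pred I})
    (a : I -> C) (u : hilbert C X) (w : I -> hilbert C X) :
  inner u (\sum_(i in A) a i *: w i) = \sum_(i in A) a i * inner u (w i).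
Proof.
under [RHS]eq_bigr do rewrite mulr_sumr.
rewrite exchange_big; apply: eq_bigr => x _.
rewrite sum_ffunE mulr_sumr; apply: eq_bigr => i _.
by rewrite ffunE mulrCA.
Qed.

(** The frame operator is linear, so tightness need only be tested on the frame
    vectors themselves. *)
Lemma tight_on_span (C : numClosedFieldType) (X I : finType) (K : {set I})
    (phi : I -> hilbert C X) (a : C) :
    (forall m, m \in K ->
      \sum_(l in K) inner (phi l) (phi m) *: phi l = a *: phi m) ->
  forall y, y \in <<[seq phi l | l in K]>>%VS ->
    \sum_(l in K) inner (phi l) y *: phi l = a *: y.
Proof.
move=> tight y /(@coord_span _ _ _ (in_tuple _)) ->.
set X' := in_tuple _.
under eq_bigr do rewrite inner_sumr scaler_suml.
rewrite exchange_big scaler_sumr /=; apply: eq_bigr => i _.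
have /imageP[m Km ->] : X'`_i \in [seq phi l | l in K] by apply: mem_nth.
rewrite scalerA mulrC -scalerA -tight // scaler_sumr.
by apply: eq_bigr => l _; rewrite scalerA.
Qed.

(** Equality case of the triangle inequality.  The off-diagonal entries in a row
    of the Gram matrix are k numbers of modulus c; as the vectors add up to 0,
    they sum to minus the diagonal entry c * k, so each of them is - c. *)
Lemma simplex_gram (C : numClosedFieldType) (X I : finType) (K : {set I})
    (phi : I -> hilbert C X) (k : nat) (c : C) :
    #|K| = k.+1 ->
    (forall l, l \in K -> inner (phi l) (phi l) = c * k%:R) ->
    (forall l m, l \in K -> m \in K -> l != m -> `|inner (phi l) (phi m)| = c) ->
    \sum_(l in K) phi l = 0 ->
  forall l m, l \in K -> m \in K ->
    inner (phi l) (phi m) = c * (if l == m then k%:R else -1).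
Proof.
move=> cardK norm_phi abs_phi sum_phi l m Kl Km.
case: eqVneq => [<-|neq_lm]; first exact: norm_phi.
rewrite mulrN1.
have : inner (phi l) (\sum_(i in K) 1 *: phi i) = 0.
  under eq_bigr do rewrite scale1r.
  by rewrite sum_phi; apply: big1 => x _; rewrite ffunE mulr0.
rewrite inner_sumr (bigD1 l) //= mul1r norm_phi // => /eqP.
rewrite addrC addr_eq0 => /eqP sum_inner.
have cardKl : #|[pred i in K | i != l]| = k.
  have := cardsD1 l K; rewrite Kl cardK add1n => -[->].
  by apply: eq_card => i; rewrite !inE andbC.
have c_ge0 : 0 <= c by rewrite -(abs_phi l m).
have abs_term i : (i \in K) && (i != l) -> `|1 * inner (phi l) (phi i)| = c.
  by case/andP=> Ki neq; rewrite mul1r abs_phi // eq_sym.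
have sum_abs : \sum_(i in K | i != l) `|1 * inner (phi l) (phi i)| = c * k%:R.
  by rewrite (eq_bigr _ abs_term) sumr_const cardKl mulr_natr.
(* The inner products with the other vectors all have the same argument t. *)
have [|t t1 tE] := normC_sum_eq (P := fun i => (i \in K) && (i != l))
   (F := fun i => 1 * inner (phi l) (phi i)).
  by rewrite sum_abs sum_inner normrN ger0_norm ?mulr_ge0 ?ler0n.
have Klm : (m \in K) && (m != l) by rewrite Km eq_sym.
have := tE m Klm; rewrite abs_term // mul1r => ->.
have [->|c_neq0] := eqVneq c 0; first by rewrite mul0r oppr0.
suff -> : t = -1 by rewrite mulrN1.
have k_gt0 : (0 < k)%N by rewrite -cardKl; apply/card_gt0P; exists m.
apply: (mulfI (_ : c * k%:R != 0)).
  by rewrite mulf_neq0 // pnatr_eq0 -lt0n.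
by rewrite mulrN1 -sum_inner (eq_bigr _ tE) -mulr_suml sum_abs.
Qed.

(** The Gram matrix is c ((k + 1) I - J).  A linear relation between the vectors
    therefore has constant coefficients, so removing any one vector leaves a
    basis of the span. *)
Lemma simplex_of_zero_sum (C : numClosedFieldType) (X I : finType) (K : {set I})
    (phi : I -> hilbert C X) (k : nat) (c : C) :
    (0 < k)%N -> 0 < c -> #|K| = k.+1 ->
    (forall l, l \in K -> inner (phi l) (phi l) = c * k%:R) ->
    (forall l m, l \in K -> m \in K -> l != m -> `|inner (phi l) (phi m)| = c) ->
    \sum_(l in K) phi l = 0 ->
  regular_simplex k K phi.
Proof.
move=> k_gt0 c_gt0 cardK norm_phi abs_phi sum_phi.
have gram := simplex_gram cardK norm_phi abs_phi sum_phi.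
have gram_sum (b : I -> C) m : m \in K ->
    \sum_(l in K) b l * inner (phi m) (phi l)
      = c * (k.+1%:R * b m - \sum_(l in K) b l).
  move=> Km; rewrite (bigD1 m) //= [in RHS](bigD1 m) //= gram // eqxx.
  rewrite (eq_bigr (fun l => - c * b l)) => [|l /andP[Kl neq]]; last first.
    by rewrite gram // eq_sym (negPf neq) mulrN1 mulrC.
  rewrite -mulr_sumr -natr1 mulrDl mul1r opprD addrA addrK mulrBr mulNr.
  by rewrite mulrCA [b m * _]mulrC.
have ck_gt0 : 0 < c * k%:R by rewrite mulr_gt0 ?ltr0n.
have [l0 Kl0] : exists l0, l0 \in K by apply/card_gt0P; rewrite cardK.
set U := <<[seq phi l | l in K]>>%VS.
have dimU : \dim U = k.
  pose E := enum (K :\ l0); pose W := [seq phi l | l <- E].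
  have sizeE : size E = k.
    by rewrite -cardE; have := cardsD1 l0 K; rewrite Kl0 cardK add1n => -[].
  have UW : U = <<W>>%VS.
    have WK l : l \in K -> l != l0 -> phi l \in <<W>>%VS.
      by move=> Kl neq; apply/memv_span/map_f; rewrite mem_enum !inE neq.
    apply/eqP; rewrite eqEsubv; apply/andP; split; apply/span_subvP=> y.
      case/imageP=> l Kl ->; have [->|] := eqVneq l l0; last exact: WK.
      move: sum_phi; rewrite (bigD1 l0) //= => /eqP.
      rewrite addr_eq0 => /eqP ->; rewrite memvN memv_suml // => i /andP[].
      exact: WK.
    case/mapP=> l; rewrite mem_enum inE => /andP[_ Kl] ->.
    by apply/memv_span/imageP; exists l.
  suff /eqP : free W by rewrite UW size_map sizeE.
  apply/(@freeP _ _ _ (in_tuple W)) => b sum0.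
  (* A relation on K minus l0 is extended to K by the coefficient 0 at l0; being
     constant on K, its coefficients all vanish. *)
  pose b' l := if insub (index l E) is Some i then b i else 0.
  have sizeW : size W = size E by rewrite size_map.
  have b'E (i : 'I_(size W)) : b' (nth l0 E i) = b i.
    have lti : (i < size E)%N by rewrite -sizeW.
    by rewrite /b' index_uniq ?enum_uniq // insubT // => lti'; congr b; apply: val_inj.
  have b'l0 : b' l0 = 0.
    rewrite /b' insubF // memNindex ?mem_enum ?inE ?eqxx //.
    by rewrite sizeW ltnn.
  have {}sum0 : \sum_(l in K) b' l *: phi l = 0.
    rewrite (bigD1 l0) //= b'l0 scale0r add0r -[RHS]sum0.
    transitivity (\sum_(l <- E) b' l *: phi l).
      by rewrite big_enum; apply: eq_bigl => l; rewrite !inE andbC.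
    rewrite (big_nth l0) -sizeW big_mkord; apply: eq_bigr => i _.
    by rewrite b'E (nth_map l0) // -sizeW.
  have inner0 m : inner (phi m) 0 = 0.
    by apply: big1 => x _; rewrite ffunE mulr0.
  have const m : m \in K -> k.+1%:R * b' m = \sum_(l in K) b' l.
    move=> Km; apply/eqP; rewrite -subr_eq0.
    have := gram_sum b' m Km; rewrite -inner_sumr sum0 inner0 => /esym/eqP.
    by rewrite mulf_eq0 (gt_eqF c_gt0).
  move=> i; rewrite -b'E; apply/eqP.
  have Ki : nth l0 E i \in K.
    have : nth l0 E i \in E by rewrite mem_nth // -sizeW.
    by rewrite mem_enum inE => /andP[].
  have := const _ Ki; rewrite -(const _ Kl0) b'l0 mulr0 => /eqP.
  by rewrite mulf_eq0 pnatr_eq0.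
split=> //; split.
- move=> l Kl; split; first by apply/memv_span/imageP; exists l.
  apply: contraTneq (ck_gt0) => phi0; rewrite -(norm_phi l Kl) phi0.
  by rewrite /inner big1 ?ltxx // => x _; rewrite ffunE mulr0.
- by exists (sqrtC (c * k%:R)) => l Kl; rewrite /hnorm norm_phi.
- by exists c.
exists (c * k.+1%:R); first by rewrite mulr_gt0 ?ltr0n.
apply: tight_on_span => m Km.
rewrite (bigD1 m) //= gram // eqxx.
rewrite (eq_bigr (fun l => - c *: phi l)) => [|l /andP[Kl neq]]; last first.
  by rewrite gram // (negPf neq) mulrN1.
move: sum_phi; rewrite (bigD1 m) //= addrC => /eqP; rewrite addr_eq0 => /eqP sumE.
by rewrite -scaler_sumr sumE scaleNr scalerN opprK -scalerDl -natr1 mulrDr mulr1.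
Qed.

(** * Sums over a difference set *)

Lemma sum_difference_set (V : zmodType) (G : finZmodType) (D : {set G})
    (lambda : nat) (F : G -> V) :
    (forall g, g != 0 -> #|[set p in setX D D | g == p.1 - p.2]| = lambda) ->
  \sum_(x in D) \sum_(y in D) F (x - y)
    = F 0 *+ #|D| + (\sum_(g | g != 0) F g) *+ lambda.
Proof.
move=> diffD; rewrite pair_big /=.
rewrite (partition_big (fun p => p.1 - p.2) predT) //= (bigD1 0) //=.
have fiber g : \sum_(p | (p.1 \in D) && (p.2 \in D) && (p.1 - p.2 == g)) F (p.1 - p.2)
    = F g *+ #|[set p in setX D D | g == p.1 - p.2]|.
  rewrite -sumr_const; apply: eq_big => [p|p /andP[_ /eqP->] //].
  by rewrite !inE eq_sym.
congr (_ + _).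
  rewrite fiber; congr (_ *+ _); rewrite -(card_imset _ (f := fun x : G => (x, x))).
    apply: eq_card => -[x y]; rewrite !inE /= eq_sym subr_eq0.
    apply/idP/imsetP => [/andP[/andP[Dx _] /eqP<-]|[z Dz [-> ->]]]; first by exists x.
    by rewrite Dz eqxx.
  by move=> x y [].
rewrite -sumrMnl; apply: eq_bigr => g g_neq0.
by rewrite fiber diffD.
Qed.

(** Both sides count the pairs of elements of D: take F constant in
    [sum_difference_set]. *)
Lemma difference_set_count (G : finZmodType) (D : {set G}) (lambda : nat) :
    (forall g, g != 0 -> #|[set p in setX D D | g == p.1 - p.2]| = lambda) ->
  (#|D| * #|D| = #|D| + lambda * (#|G| - 1))%N.
Proof.
move=> /(sum_difference_set (fun _ => 1 : int)).
rewrite !sumr_const -mulrnA => /eqP.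
have -> : #|(fun g : G => g != 0)| = (#|G| - 1)%N.
  by have := cardC1 (0 : G); rewrite subn1 => <-; apply: eq_card.
by rewrite -mulrnA -mulrnDr eqr_nat mulnC [(lambda * _)%N]mulnC => /eqP.
Qed.

(** * Harmonic frames of difference sets *)

Lemma inner_harmonic (C : numClosedFieldType) (G : finZmodType) (D : {set G})
    (chi psi : pontryagin C G) :
  inner (harmonic C D chi) (harmonic C D psi) = \sum_(x in D) (chi x)^* * psi x.
Proof. by rewrite big_sub; apply: eq_bigr => x _; rewrite !ffunE. Qed.

Lemma inner_harmonic_same (C : numClosedFieldType) (G : finZmodType)
    (D : {set G}) (chi : pontryagin C G) :
  inner (harmonic C D chi) (harmonic C D chi) = #|D|%:R.
Proof.
rewrite inner_harmonic -sumr_const; apply: eq_bigr => x _.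
by rewrite mulrC -normCK dual_norm expr1n.
Qed.

(** With F = conj chi * psi, the square is the sum of F (x - y) over x, y in D,
    namely #|D| + lambda times the sum of F over the nonzero elements; the latter
    is - 1 because F sums to 0 over G. *)
Lemma sqr_norm_inner_harmonic (C : numClosedFieldType) (G : finZmodType)
    (D : {set G}) (lambda : nat) (chi psi : pontryagin C G) :
    (forall g, g != 0 -> #|[set p in setX D D | g == p.1 - p.2]| = lambda) ->
    chi != psi ->
  `|inner (harmonic C D chi) (harmonic C D psi)| ^+ 2 = #|D|%:R - lambda%:R.
Proof.
move=> diffD neq_cp; rewrite inner_harmonic normCK rmorph_sum mulr_suml.
pose F x := (chi x)^* * psi x.
have FB x y : F x * (F y)^* = F (x - y).
  by rewrite /F !dualD !dualN !rmorphM /= !conjCK mulrACA.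
under eq_bigr => x _ do rewrite mulr_sumr; rewrite -/(F _).
transitivity (\sum_(x in D) \sum_(y in D) F (x - y)).
  by apply: eq_bigr => x _; apply: eq_bigr => y _; rewrite -FB.
rewrite (sum_difference_set _ diffD).
have F0 : F 0 = 1 by rewrite /F !dual0 conjC1 mulr1.
have := character_orthogonalityT chi psi; rewrite (negPf neq_cp) (bigD1 0) //=.
rewrite -/(F 0) F0 addrC => /eqP; rewrite addr_eq0 => /eqP ->.
by rewrite mulNrn.
Qed.

(** Poisson summation on the coset chi H-perp: row orthogonality on H turns the
    indicator function of the coset into an average over H, and column
    orthogonality then keeps only the term h = - x. *)
Lemma sum_dual_coset (C : numClosedFieldType) (G : finZmodType)
    (H : {group G}) (chi : pontryagin C G) x :
  #|H|%:R * (\sum_(psi : pontryagin C G | [forall h in H, chi h == psi h]) psi x)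
    = if x \in H then #|G|%:R * chi x else 0.
Proof.
transitivity (\sum_(psi : pontryagin C G) (\sum_(h in H) (chi h)^* * psi h) * psi x).
  rewrite mulr_sumr big_mkcond; apply: eq_bigr => psi _.
  by rewrite character_orthogonality; case: ifP; rewrite ?mul0r.
under eq_bigr do rewrite mulr_suml.
rewrite exchange_big /=.
transitivity (\sum_(h in H) (chi h)^* * (if h == - x then #|G|%:R else 0)).
  apply: eq_bigr => h Hh; rewrite -addr_eq0 -(sum_characters C) mulr_sumr.
  by apply: eq_bigr => psi _; rewrite dualD mulrA.
have HN : (- x \in H) = (x \in H) by rewrite -FinRing.zmodVgE groupV.
case: ifP => Hx; last first.
  apply: big1 => h Hh; rewrite (_ : (h == - x) = false) ?mulr0 //.
  by apply: contraTF Hh => /eqP->; rewrite HN Hx.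
rewrite (bigD1 (- x)) ?HN //= eqxx dualN conjCK big1 ?addr0 1?mulrC //.
by move=> h /andP[_ /negPf->]; rewrite mulr0.
Qed.

(** The entry of the frame operator at (g, x) is the sum over all characters of
    their value at g - x, so tightness is column orthogonality. *)
Lemma harmonic_is_ETF (C : numClosedFieldType) (G : finZmodType) (D : {set G})
    (c : C) :
    (0 < #|D|)%N ->
    (forall chi psi : pontryagin C G, chi != psi ->
      `|inner (harmonic C D chi) (harmonic C D psi)| = c) ->
  is_ETF [set: pontryagin C G] (harmonic C D) fullv.
Proof.
move=> D_gt0 abs_inner; split.
- move=> chi _; rewrite memvf; split=> //.
  apply: contraTneq D_gt0 => chi0; rewrite -leqNgt leqn0 -(pnatr_eq0 C).
  rewrite -(inner_harmonic_same D chi) chi0 /inner big1 // => x _.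
  by rewrite ffunE mulr0.
- by exists (sqrtC #|D|%:R) => chi _; rewrite /hnorm inner_harmonic_same.
- by exists c => chi psi _ _; apply: abs_inner.
exists #|G|%:R; first by rewrite ltr0n; apply/card_gt0P; exists 0.
move=> y _; apply/ffunP => g.
rewrite sum_ffunE ffunE.
transitivity (\sum_(chi : pontryagin C G) \sum_x chi (val g - val x) * y x).
  apply: eq_big => [chi|chi _]; first by rewrite inE.
  rewrite ffunE /inner -[LHS]/(_ * _) mulr_suml; apply: eq_bigr => x _.
  by rewrite !ffunE dualD dualN mulrAC [in RHS](mulrC (chi _)).
rewrite exchange_big (bigD1 g) //= -mulr_suml sum_characters subrr eqxx.
rewrite big1 ?addr0 // => x neq_xg.
rewrite -mulr_suml sum_characters subr_eq0 eq_sym (inj_eq val_inj).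
by rewrite (negPf neq_xg) mul0r.
Qed.

(** The relation between k, #|D| and #|G| is the squared formula for s, cleared of
    denominators. *)
Lemma harmonic_simplices (C : numClosedFieldType) (G : finZmodType)
    (D : {set G}) (H : {group G}) (k : nat) :
    difference_set D -> (0 < #|D|)%N -> (#|D| < #|G|)%N ->
    (k ^ 2 * (#|G| - #|D|) = #|D| * (#|G| - 1))%N ->
    (#|H| * k.+1 = #|G|)%N ->
    [disjoint H & D] ->
  ETF_disjoint_union_of_simplices #|H| k (harmonic C D).
Proof.
move=> [lambda diffD] D_gt0 ltDG kE HkE disHD.
have G_gt1 : (1 < #|G|)%N by apply: leq_ltn_trans ltDG.
have k_gt0 : (0 < k)%N.
  rewrite lt0n; apply: contraTneq G_gt1 => k0; rewrite -leqNgt -subn_eq0.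
  by move/esym/eqP: kE; rewrite k0 muln_eq0 eqn0Ngt D_gt0.
have lambdaE : ((#|D| - lambda) * (#|G| - 1) = #|D| * (#|G| - #|D|))%N.
  have -> : (#|G| - #|D| = (#|G| - 1) - (#|D| - 1))%N.
    by rewrite subnBA // subnK ?(ltnW G_gt1).
  rewrite mulnBl [RHS]mulnBr; congr (_ - _)%N.
  by rewrite [RHS]mulnBr muln1 (difference_set_count diffD) addKn.
have H_gt0 : (0 < #|H|)%N := cardG_gt0 H.
(* c is the Welch bound. *)
pose c : C := #|D|%:R / k%:R.
have ck : c * k%:R = #|D|%:R by rewrite divfK // pnatr_eq0 -lt0n.
have c_gt0 : 0 < c by rewrite divr_gt0 ?ltr0n.
have abs_inner (chi psi : pontryagin C G) : chi != psi ->
    `|inner (harmonic C D chi) (harmonic C D psi)| = c.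
  move=> neq_cp; apply: (pexpIrn (isT : 0 < 2)%N); rewrite ?nnegrE ?normr_ge0 //.
    exact: ltW.
  rewrite (sqr_norm_inner_harmonic diffD neq_cp).
  have le_lambda_D : (lambda <= #|D|)%N.
    have [x Dx] := card_gt0P D_gt0.
    have G1_gt0 : (0 < #|G| - 1)%N by rewrite subn_gt0.
    rewrite -(leq_pmul2r G1_gt0) -(leq_add2l #|D|) -(difference_set_count diffD).
    by rewrite -mulnS subn1 prednK ?(ltnW G_gt1) // leq_mul2l (ltnW ltDG) orbT.
  (* Multiplying by k ^ 2 * (#|G| - 1) turns #|D| - lambda = c ^ 2 into an
     identity between natural numbers. *)
  have k2_neq0 : k%:R ^+ 2 * (#|G| - 1)%:R != 0 :> C.
    by rewrite -natrX -natrM pnatr_eq0 -lt0n muln_gt0 expn_gt0 k_gt0 subn_gt0.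
  apply: (mulIf k2_neq0); rewrite [RHS]mulrA -exprMn ck -natrB //.
  rewrite -!natrX -!natrM; congr _%:R.
  by rewrite mulnCA lambdaE mulnCA kE mulnA mulnn.
split; first exact: harmonic_is_ETF abs_inner.
(* The fibres of f, which encodes restriction to H, are the cosets of H-perp. *)
pose f (chi : pontryagin C G) := [ffun x => if x \in H then chi x else 0].
have fE chi psi : (f chi == f psi) = [forall h in H, chi h == psi h].
  apply/eqP/forall_inP => [/ffunP eq_f h Hh|eq_H].
    by apply/eqP; have := eq_f h; rewrite !ffunE Hh.
  by apply/ffunP => x; rewrite !ffunE; case: ifP => // /eq_H/eqP.
have P_part := preim_partitionP f [set: pontryagin C G].
set P := preim_partition _ _ in P_part.
have blockP K : K \in P -> exists chi : pontryagin C G, forall x,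
    \sum_(psi in K) psi x = if x \in H then k.+1%:R * chi x else 0.
  case/imsetP=> chi _ ->; exists chi => x.
  have H_neq0 : #|H|%:R != 0 :> C by rewrite pnatr_eq0 -lt0n.
  apply: (mulfI H_neq0); rewrite [RHS]fun_if mulr0 mulrA -natrM HkE.
  rewrite -sum_dual_coset; congr (_ * _).
  by apply: eq_bigl => psi; rewrite !inE fE.
have cardK K : K \in P -> #|K| = k.+1.
  have H0 : 0 \in H by rewrite -FinRing.zmod1gE group1.
  move=> /blockP[chi /(_ 0)/eqP]; rewrite H0 dual0 mulr1.
  under eq_bigr do rewrite dual0.
  by rewrite sumr_const eqr_nat => /eqP.
have cardG : #|{: pontryagin C G}| = #|G|.
  have /eqP := sum_characters C (0 : G); rewrite eqxx.
  by under eq_bigr do rewrite dual0; rewrite sumr_const eqr_nat => /eqP.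
exists P; split=> //.
  have := card_uniform_partition cardK P_part.
  by rewrite cardsT cardG -HkE => /eqP; rewrite eqn_pmul2r // => /eqP.
move=> K PK; apply: (@simplex_of_zero_sum _ _ _ _ _ k c) => //.
- exact: cardK.
- by move=> chi _; rewrite inner_harmonic_same ck.
- by move=> chi psi _ _; apply: abs_inner.
(* D avoids H, so the sums over a block vanish on D. *)
apply/ffunP => g; rewrite sum_ffunE ffunE.
have [chi /(_ (val g))] := blockP K PK.
rewrite (disjointFl disHD (valP g)) => sum0; rewrite -[RHS]sum0.
by apply: eq_bigr => psi _; rewrite ffunE.
Qed.

Theorem theorem7p1 (R : realType) (G : finZmodType) (D : {set G})
    (d n v : nat) (s : R) (H : {group G}) :
  difference_set D ->
  #|D| = d -> #|G| = n -> (1 <= d)%N -> (d < n)%N ->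
  s = Num.sqrt (d%:R * (n%:R - 1) / (n%:R - d%:R)) ->
  v%:R = n%:R / (s + 1) ->
  #|H| = v ->
  [disjoint H & D] ->
  exists2 k : nat, s = k%:R &
    ETF_disjoint_union_of_simplices v k (harmonic R[i] D).
Proof.
move=> diffD <- <- D_gt0 ltDG sE vE cardH disHD; rewrite -{v}cardH in vE *.
have s_ge0 : 0 <= s by rewrite sE sqrtr_ge0.
have s1_neq0 : s + 1 != 0 by rewrite gt_eqF // ltr_wpDl.
(* Lagrange makes s + 1 = n / v a natural number q. *)
have [q qE] : exists q, #|G| = (#|H| * q)%N.
  have /dvdnP[q qE] : (#|H| %| #|[set: G]|)%N by rewrite cardSg ?subsetT.
  by exists q; rewrite mulnC -qE cardsT.
have G_gt0 : (0 < #|G|)%N by apply: leq_ltn_trans ltDG.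
have q_gt0 : (0 < q)%N by move: G_gt0; rewrite qE muln_gt0 => /andP[].
have sq : s + 1 = q%:R.
  have H_neq0 : #|H|%:R != 0 :> R by rewrite pnatr_eq0 -lt0n.
  by apply: (mulfI H_neq0); rewrite -natrM -qE vE divfK.
have sk : s = q.-1%:R.
  by rewrite -[LHS](addrK 1) sq -[in LHS](prednK q_gt0) -natr1 addrK.
exists q.-1 => //; apply: harmonic_simplices => //; last by rewrite prednK.
have den_gt0 : 0 < #|G|%:R - #|D|%:R :> R by rewrite subr_gt0 ltr_nat.
apply/eqP; rewrite -(eqr_nat R) (natrM _ #|D|) (natrM _ (_ ^ 2)) natrX.
rewrite !natrB ?(ltnW ltDG) //.
rewrite -sk sE sqr_sqrtr ?divfK ?(lt0r_neq0 den_gt0) //.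
by rewrite mulr_ge0 ?invr_ge0 ?(ltW den_gt0) // mulr_ge0 ?subr_ge0 ?ler1n.
Qed.
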